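(* Consider the stochastic $n$th-order continuous-time problem of maximizing $\int_0^\infty E\,v(\mathbf{x}(t,\omega),\dot{\mathbf{x}}(t,\omega),\ldots,\mathbf{x}^{(n)}(t,\omega),t,\omega)\,dt$ subject to $\mathbf{x}(0,\omega)=\mathbf{x}_0(\omega)$ and $(\mathbf{x}(t,\omega),\dot{\mathbf{x}}(t,\omega),\ldots,\mathbf{x}^{(n)}(t,\omega))\in X(t,\omega)\subset(\mathbb{R}^N)^{n+1}$ for all $t\ge 0$, with the setting, the notion of optimality, the perturbation curves $\mathbf{p}$ and Assumptions 1, 2, 3 as specified in the context. Under Assumptions 1, 2 and 3, for any interior optimal path $\mathbf{x}^*(t,\omega)$, writing $v_k=v_k(\mathbf{x}^*(t,\omega),\dot{\mathbf{x}}^*(t,\omega),\ldots,\mathbf{x}^{*(n)}(t,\omega),t,\omega)$: (a) the Euler equation is $$v_1-(v_2)'+\cdots+(-1)^n(v_{n+1})^{(n)}=0;$$ (b) the transversality condition is $$\liminf_{T\to\infty}E\Big[\mathbf{p}\big(v_2-(v_3)'+\cdots+(-1)^{n-1}(v_{n+1})^{(n-1)}\big)+\dot{\mathbf{p}}\big(v_3-(v_4)'+\cdots+(-1)^{n-2}(v_{n+1})^{(n-2)}\big)+\cdots+\mathbf{p}^{(n-1)}v_{n+1}\Big]_0^T\le 0,$$ where $\mathbf{p}=\mathbf{p}(t,\omega)$ is an arbitrary $n$th-order continuously differentiable perturbation curve satisfying Assumptions 1, 2 and 3.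
   Context: Setting. $(\Omega,F,P)$ is a probability space, $Ez=\int z(\omega)\,dP(\omega)$, $N$ is a positive integer and $n$ is the order of the problem. $v$ is a real-valued $n$th-order continuously differentiable function whose domain is $X(t,\omega)\subset(\mathbb{R}^N)^{n+1}$ for each $t,\omega$; paths $\mathbf{x}(t,\omega)\in\mathbb{R}^N$ are $n$th-order continuously differentiable in $t$, and dots and superscripts $(k)$ denote $t$-derivatives. There is a sequence of real vector spaces $\{B_t\}_{t=0}^\infty$ such that the initial condition lies in $F(\Omega,B_0)$ and, for all $t$, the constraint set at $t$ is contained in $F(\Omega,B_t)\times F(\Omega,B_{t+1})\times\cdots\times F(\Omega,B_{t+n})$, where $F(\Omega,B)$ denotes the set of functions from $\Omega$ to $B$. For every $t\ge0$ and every $(\mathbf{x}(t,\omega),\ldots,\mathbf{x}^{(n)}(t,\omega))\in X(t,\omega)$: (i) $v(\mathbf{x}(t,\omega),\ldots,\mathbf{x}^{(n)}(t,\omega),t,\omega)\in[-\infty,\infty)$ for all $\omega\in\Omega$; (ii) this is a measurable function of $\omega$; (iii) its expectation exists in $[-\infty,\infty)$. The objective functional need not be finite. Notation. $v_k$ ($1\le k\le n+1$) is the partial derivative of $v$ with respect to its $k$th argument, i.e. with respect to $\mathbf{x}^{(k-1)}$; $(v_k)'$ and $(v_k)^{(j)}$ are derivatives with respect to $t$ along $\mathbf{x}^*$. Products of a derivative of $\mathbf{p}$ with an expression in the $v_k$ are inner products in $\mathbb{R}^N$. $[f(t)]_0^T=f(T)-f(0)$. Perturbations. The optimal path $\mathbf{x}^*$,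 interior to $X(t,\omega)$, is perturbed to $\mathbf{x}=\mathbf{x}^*+\varepsilon\mathbf{p}$ with $\mathbf{p}(t,\omega)$ an $n$th-order continuously differentiable curve. Put $$A(T',\varepsilon)=\int_0^{T'}\frac{1}{\varepsilon}\Big(Ev(\mathbf{x}^*+\varepsilon\mathbf{p},\dot{\mathbf{x}}^*+\varepsilon\dot{\mathbf{p}},\ldots,\mathbf{x}^{*(n)}+\varepsilon\mathbf{p}^{(n)},t,\omega)-Ev(\mathbf{x}^*,\dot{\mathbf{x}}^*,\ldots,\mathbf{x}^{*(n)},t,\omega)\Big)dt$$ (taken to exist) and $V(\varepsilon,T)=\inf_{T'\ge T}\varepsilon A(T',\varepsilon)$ for $\varepsilon>0$. Optimality (weak maximality). An attainable path $\mathbf{x}^*$ is optimal if no other attainable path overtakes it: $\lim_{T\to\infty}V(\varepsilon,T)\le0$. Assumption 1. In $\Pi=\lim_{\varepsilon\to0^+}\frac1\varepsilon\lim_{T\to\infty}V(\varepsilon,T)=\lim_{\varepsilon\to0^+}\lim_{T\to\infty}\inf_{T'\ge T}A(T',\varepsilon)$, the convergence as $T\to\infty$ is uniform in $\varepsilon$. Assumption 2. For any $T>0$, $\inf_{T'\ge T}A(T',\varepsilon)$ converges uniformly in $\varepsilon$; that is, there is a sequence $A(T'_m,\varepsilon)$ for each $\varepsilon>0$ with $\lim_{m\to\infty}A(T'_m,\varepsilon)=\inf_{T'\ge T}A(T',\varepsilon)$, uniformly in $\varepsilon$. Assumption 3. With $m_t(\varepsilon,\omega)=\frac1\varepsilon\big(v(\mathbf{x}^*+\varepsilon\mathbf{p},\ldots,\mathbf{x}^{*(n)}+\varepsilon\mathbf{p}^{(n)},t,\omega)-v(\mathbf{x}^*,\ldots,\mathbf{x}^{*(n)},t,\omega)\big)$,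 there exists $\hat m_t(\tilde\varepsilon,\omega)$ such that $|m_t(\varepsilon,\omega)|<\hat m_t(\tilde\varepsilon,\omega)$ for $\varepsilon\in(0,\tilde\varepsilon]$.
   Formalization: Added: t-derivatives of v_k along x* exist and are continuous; the bound in Assumption 3 is integrable; T'_m in Assumption 2 is bounded in ε for each m; for (a), small localized perturbations are attainable and satisfy Assumptions 1-3; the Euler equation holds almost surely. *)

(* Defs.v *)
From HB Require Import structures.
From mathcomp Require Import all_boot all_order all_algebra.
From mathcomp Require Import all_classical all_reals all_analysis.
From mathcomp Require Import measurable_realfun.

Set Implicit Arguments.
Unset Strict Implicit.
Unset Printing Implicit Defensive.

Import Order.TTheory GRing.Theory Num.Theory.
Import numFieldNormedType.Exports.

Local Open Scope classical_set_scope.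
Local Open Scope ring_scope.

Section calculus.
Context {R : realType}.

(* Time runs over [0, +oo[, so derivatives in t are relative to that half-line:
   the usual derivative for t > 0, the right derivative at 0.  Nothing that
   happens at negative times matters. *)
Definition tquot (V : normedModType R) (f : R -> V) (t h : R) : V :=
  h^-1 *: (f (t + h) - f t).

Definition tderiv (V : normedModType R) (f : R -> V) (t : R) : V :=
  lim (tquot f t h @[h --> within [set h | 0 <= t + h] 0^']).

Definition tderivable (V : normedModType R) (f : R -> V) (t : R) : Prop :=
  cvg (tquot f t h @[h --> within [set h | 0 <= t + h] 0^']).

Definition tderivn (V : normedModType R) (k : nat) (f : R -> V) : R -> V :=
  iter k (@tderiv V) f.

Definition tCn (V : normedModType R) (k : nat) (f : R -> V) : Prop :=
  (forall j, (j < k)%N -> forall t, 0 <= t -> tderivable (tderivn j f) t) /\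
  (forall j, (j <= k)%N -> {within `[0, +oo[, continuous (tderivn j f)}).

(* k-times continuous differentiability on an open set A of a
   finite-dimensional space. *)
Fixpoint Ck_on (V : normedModType R) (k : nat) (A : set V) (f : V -> R) : Prop :=
  match k with
  | 0 => forall x, A x -> {for x, continuous f}
  | k'.+1 => (forall x, A x -> differentiable f x) /\
             (forall u : V, Ck_on k' A ('D_u f))
  end.

Definition inner (N : nat) (a b : 'rV[R]_N) : R := \sum_(i < N) a 0 i * b 0 i.

(* [integral_exists mu D f]: the Lebesgue integral of f over D makes sense in
   [-oo, +oo], i.e. it is not of the form +oo - +oo. *)
Definition integral_exists d (T : measurableType d)
    (mu : {measure set T -> \bar R}) (D : set T) (f : T -> \bar R) : Prop :=
  measurable_fun D f /\
  ((\int[mu]_(x in D) (f^\+ x) < +oo)%E \/ (\int[mu]_(x in D) (f^\- x) < +oo)%E).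

End calculus.

Section problem.
Context {R : realType} {d : measure_display} {Omega : measurableType d}.
Variable P : probability Omega R.
Context {N n : nat}.

(* A point of (R^N)^(n+1) is an (n+1) x N matrix; row k is the argument that
   receives the k-th time derivative of the path. *)
Variable X : R -> Omega -> set 'M[R]_(n.+1, N).
Variable v : 'M[R]_(n.+1, N) -> R -> Omega -> R.
Variable x0 : Omega -> 'rV[R]_N.

Definition constraint_set (t : R) : set (Omega -> 'M[R]_(n.+1, N)) :=
  [set z | forall w, X t w (z w)].

Definition value_spaces : Prop :=
  exists B : R -> {vspace 'rV[R]_N},
    (forall w, x0 w \in B 0) /\
    (forall t, 0 <= t -> forall z, constraint_set t z ->
       forall (k : 'I_n.+1) w, row k (z w) \in B (t + k%:R)).

Definition jet (x : R -> Omega -> 'rV[R]_N) (t : R) (w : Omega) :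
  'M[R]_(n.+1, N) := \matrix_(k < n.+1, i < N) tderivn k (x ^~ w) t 0 i.

(* The conditions on v (measurability in w, expectation in [-oo, +oo[) are part
   of attainability; that v itself avoids +oo is built into v being real-valued. *)
Definition attainable (x : R -> Omega -> 'rV[R]_N) : Prop :=
  [/\ forall w, tCn n (x ^~ w),
      forall w, x 0 w = x0 w,
      forall t, 0 <= t -> constraint_set t (jet x t)
    & forall t, 0 <= t ->
        measurable_fun setT (fun w => v (jet x t w) t w) /\
        (\int[P]_w ((fun w => (v (jet x t w) t w)%:E)^\+ w) < +oo)%E].

Definition perturb (x p : R -> Omega -> 'rV[R]_N) (e : R) :=
  fun t w => x t w + e *: p t w.

Section along_path.
Variable x : R -> Omega -> 'rV[R]_N.

Definition Ev_perturbed (p : R -> Omega -> 'rV[R]_N) (e t : R) : \bar R :=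
  ('E_P[fun w => v (jet x t w + e *: jet p t w) t w])%E.

Definition Ev (t : R) : \bar R := ('E_P[fun w => v (jet x t w) t w])%E.

Definition A_integrand p (e t : R) : \bar R :=
  ((e^-1)%:E * (Ev_perturbed p e t - Ev t))%E.

Definition A_fun p (T' e : R) : \bar R :=
  (\int[lebesgue_measure]_(t in `[0%R, T']) A_integrand p e t)%E.

Definition A_exists p (e : R) : Prop :=
  (forall t, 0 <= t -> (Ev_perturbed p e t +? - Ev t)%E) /\
  (forall T', 0 <= T' ->
     integral_exists (@lebesgue_measure R) `[0, T'] (A_integrand p e)).

Definition V_fun p (e T : R) : \bar R :=
  ereal_inf [set (e%:E * A_fun p T' e)%E | T' in `[T, +oo[].

Definition optimal : Prop :=
  attainable x /\
  forall p e, 0 < e -> attainable (perturb x p e) -> A_exists p e ->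
    (lim (V_fun p e T @[T --> +oo%R]) <= 0)%E.

Definition interior_path : Prop :=
  forall t w, 0 <= t -> interior (X t w) (jet x t w).

(* For some range ]0, et] of sizes of the perturbation. *)
Definition perturbation_curve p (et : R) : Prop :=
  (forall w, tCn n (p ^~ w)) /\
  (forall e, 0 < e <= et -> attainable (perturb x p e) /\ A_exists p e).

Definition infA p (T e : R) : \bar R :=
  ereal_inf [set A_fun p T' e | T' in `[T, +oo[].

(* infA is nondecreasing in T, so the inner limit always exists in [-oo, +oo];
   uniformity refers to the uniform structure of [-oo, +oo], which is implied by
   uniformity in the usual sense when the quantities are finite. *)
Definition assumption1 p (et : R) : Prop :=
  {uniform `]0, et], infA p T @[T --> +oo%R] -->
     (fun e => lim (infA p T e @[T --> +oo%R]))}.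

(* [S m e] is the m-th term of the minimizing sequence of times for e.  It may
   vary with e, but for fixed m it stays in a bounded set: if S m e were allowed
   to escape to infinity as e tends to 0, every infimum would be a uniform limit
   of this kind and the condition would be void. *)
Definition assumption2 p (et : R) : Prop :=
  forall T, 0 < T -> exists S : nat -> R -> R,
    [/\ forall m e, 0 < e <= et -> T <= S m e,
        forall m, exists K, forall e, 0 < e <= et -> S m e <= K
      & {uniform `]0, et], (fun e => A_fun p (S m e) e) @[m --> \oo] --> infA p T}].

Definition diff_quot p (t e : R) (w : Omega) : R :=
  e^-1 * (v (jet x t w + e *: jet p t w) t w - v (jet x t w) t w).

(* [mhat] is a dominating function in the sense of Lebesgue's theorem, for the
   expectation and for the integral over each bounded time interval. *)
Definition assumption3 p (et : R) : Prop :=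
  exists mhat : R -> Omega -> R,
    [/\ forall t e w, 0 <= t -> 0 < e <= et ->
          `|diff_quot p t e w| < mhat t w,
        forall t, 0 <= t -> P.-integrable setT (EFin \o mhat t)
      & forall T', 0 <= T' ->
          (@lebesgue_measure R).-integrable `[0, T'] (fun t => 'E_P[mhat t]%E)].

Definition assumptions123 p : Prop :=
  exists2 et, 0 < et &
    [/\ perturbation_curve p et, assumption1 p et, assumption2 p et
      & assumption3 p et].

(* The assumptions on the perturbations that localize in time and in Omega:
   p(t, w) = phi(t) c(w) 1_F(w) u with phi compactly supported in ]0, T[.  The
   positive random scale c accounts for a margin of interiority of x on [0, T]
   that depends on w. *)
Definition localized_assumptions : Prop :=
  forall T, 0 < T -> exists c : Omega -> R,
    [/\ measurable_fun setT c, forall w, 0 < c w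
      & forall (phi : R -> R) (a b : R) (F : set Omega) (u : 'rV[R]_N),
          0 < a -> b < T -> tCn n (phi : R -> R^o) ->
          (forall t, ~ (a <= t <= b) -> phi t = 0) ->
          measurable F ->
          assumptions123 (fun t w => (phi t * (c w * \1_F w)) *: u)].

(* Gradient of v in its k-th block of variables (k counted from 0), taken along
   the path. *)
Definition v_ (k : 'I_n.+1) (w : Omega) (t : R) : 'rV[R]_N :=
  \row_(i < N) 'D_(delta_mx k i) (fun z => v z t w) (jet x t w).

(* Existence and continuity of the t-derivatives that the Euler equation is
   written with.  For n >= 2 this does not follow from v and x being of class
   C^n, not even along extremals: a total derivative v = d/dt g(x, x', t) is
   stationary along every x, while v_3 = dg/dx' need not be twice
   differentiable along x. *)
Definition euler_regular : Prop := forall (k : 'I_n.+1) w, tCn k (v_ k w).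

Definition euler_lhs (t : R) (w : Omega) : 'rV[R]_N :=
  \sum_(k < n.+1) (-1) ^+ k *: tderivn k (v_ k w) t.

Definition boundary (p : R -> Omega -> 'rV[R]_N) (t : R) (w : Omega) : R :=
  \sum_(j < n) inner (tderivn j (p ^~ w) t)
    (\sum_(k < n.+1 | (j < k)%N)
       (-1) ^+ (k - j.+1) *: tderivn (k - j.+1) (v_ k w) t).

End along_path.
End problem.

(* Main.v *)
(* Let G(T) be the integral over [0, T] of E of the first variation
   sum_k <v_k, p^(k)>.  Dominated convergence gives A(T, e) -> G(T) as e -> 0+,
   uniformly for T in bounded intervals.  Optimality makes the infimum of
   A(T', e) over T' >= T nonpositive for each e, and Assumption 2 nearly attains it
   at times bounded independently of e; hence G(T') <= eta for some T' >= T,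
   whatever T and eta > 0.

   Fubini and integration by parts in t, for fixed w, rewrite G(T) as
   E[int_0^T <p, Euler> + boundary terms].  For p a bump in t supported in [a, b]
   times the indicator of an event, the boundary terms vanish and G is constant
   for T >= b, so int phi <u, Euler> dt <= 0 almost surely; letting a, b run over
   the rationals and u over the signed basis vectors forces Euler = 0 outside one
   null set.  For a general p only the boundary terms then remain, which is the
   transversality condition. *)

Require Import Defs.
From HB Require Import structures.
From mathcomp Require Import all_boot all_order all_algebra.
From mathcomp Require Import all_classical all_reals all_analysis.
From mathcomp Require Import measurable_realfun.
From mathcomp Require Import ring.

Set Implicit Arguments.
Unset Strict Implicit.
Unset Printing Implicit Defensive.

Import Order.TTheory GRing.Theory Num.Theory.
Import numFieldNormedType.Exports.

Local Open Scope classical_set_scope.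
Local Open Scope ring_scope.

(** * Derivatives on the half-line *)

Section tderiv.
Context {R : realType}.
Implicit Types (V : normedModType R) (t : R).

(** Increments [h] that tend to 0 with [t + h] in the half-line: two-sided for t > 0, one-sided at t
    = 0. *)
Definition tfilter t := within [set h : R | 0 <= t + h] (0^' : set_system R).

Lemma tfilter_proper t : 0 <= t -> ProperFilter (tfilter t).
Proof.
move=> t0; have wf : Filter (tfilter t) by apply: (@within_filter _ _ _ (dnbhs_filter (0:R))).
apply: Build_ProperFilter_ex.
rewrite /tfilter => A; rewrite /within/= => /nbhs_ballP[e /= e0 eA].
exists (e / 2); apply: eA => /=.
- by rewrite /ball/= sub0r normrN gtr0_norm ?divr_gt0// ltr_pdivrMr// ltr_pMr// ltr1n.
- by rewrite gt_eqF// divr_gt0.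
- by rewrite addr_ge0// divr_ge0// ltW.
Qed.

Lemma tfilter_gt0 t : 0 < t -> tfilter t = 0^'.
Proof.
move=> t0; apply/seteqP; split => A; last first.
  by rewrite /tfilter /within/=; apply: filterS.
rewrite /tfilter /within/= => H.
have : \forall h \near (0:R)^', 0 <= t + h.
  apply/nbhs_ballP; exists t => //= h; rewrite /ball/= sub0r normrN => ht _.
  by rewrite -lerBlDl sub0r; move: ht; rewrite ltr_norml => /andP[/ltW].
by move: H; apply: filterS2 => h /= H /H.
Qed.

Lemma tderiv_cvg V (f : R -> V) t :
  tderivable f t -> tquot f t h @[h --> tfilter t] --> tderiv f t.
Proof. by []. Qed.

Lemma tderiv_unique V (f : R -> V) t l : 0 <= t ->
  tquot f t h @[h --> tfilter t] --> l -> tderivable f t /\ tderiv f t = l.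
Proof.
move=> t0 fl; have := tfilter_proper t0 => pf; split.
  by apply/cvg_ex; exists l.
exact: cvg_lim fl.
Qed.

(** For t > 0 the constraint on the increments is eventually void. At t = 0 only a right derivative
    is given; this is enough for the fundamental theorem of calculus, which asks for derivatives
    inside the interval only. *)
Lemma tderiv_is_derive V (f : R -> V) t : 0 < t -> tderivable f t ->
  is_derive t (1:R) f (tderiv f t).
Proof.
move=> t0 /tderiv_cvg; rewrite (tfilter_gt0 t0) => ft.
have ft' : h^-1 *: (f (h *: (1:R) + t) - f t) @[h --> (0:R)^'] --> tderiv f t.
  apply: cvg_trans ft; apply: near_eq_cvg; near=> h.
  by rewrite /tquot /= [h *: _]mulr1 [t + h]addrC.
apply: DeriveDef; first exact: (cvgP _ ft').
exact: cvg_lim ft'.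
Unshelve. all: by end_near. Qed.

Lemma is_derive_tderiv V (f : R -> V) t l : 0 <= t ->
  is_derive t (1:R) f l -> tderivable f t /\ tderiv f t = l.
Proof.
move=> t0 [ft dl]; apply: tderiv_unique => //.
have : h^-1 *: (f (h *: (1:R) + t) - f t) @[h --> (0:R)^'] --> l.
  by rewrite -dl; exact: ft.
move=> H; have pf := tfilter_proper t0.
have H1 : h^-1 *: (f (h *: (1:R) + t) - f t) @[h --> tfilter t] --> l.
  apply: cvg_trans H => A HA; rewrite /tfilter /fmap /within /nbhs/=.
  by apply: (@filterS _ _ (dnbhs_filter (0:R)) _ _ _ HA) => h + _.
apply: cvg_trans H1; apply: near_eq_cvg; apply: nearW => h.
by rewrite /tquot /= [h *: _]mulr1 [t + h]addrC.
Qed.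

Lemma tquot_near_ext V (f g : R -> V) t : 0 <= t ->
  (\forall s \near t, 0 <= s -> f s = g s) ->
  {near tfilter t, tquot f t =1 tquot g t}.
Proof.
move=> t0 fg; have ftgt : f t = g t by exact: (nbhs_singleton fg).
have /nbhs_ballP[e /= e0 eA] := fg.
rewrite /tfilter /within/=.
apply/nbhs_ballP; exists e => //= h; rewrite /ball/= sub0r normrN => he _ th.
by rewrite /tquot ftgt eA// /ball/= opprD addNKr normrN.
Qed.

(** The difference quotient samples functions at nonnegative times only. Identities known just for t
    >= 0 can therefore be differentiated again in inductions on the order. *)
Lemma tderivable_near_ext V (f g : R -> V) t : 0 <= t ->
  (\forall s \near t, 0 <= s -> f s = g s) -> tderivable f t ->
  tderivable g t /\ tderiv g t = tderiv f t.
Proof.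
move=> t0 /(tquot_near_ext t0) fg /tderiv_cvg ft.
by apply: tderiv_unique => //; apply: cvg_trans ft; apply: near_eq_cvg.
Qed.

Lemma tderivD V (f g : R -> V) t : 0 <= t -> tderivable f t -> tderivable g t ->
  tderivable (fun s => f s + g s) t /\
  tderiv (fun s => f s + g s) t = tderiv f t + tderiv g t.
Proof.
move=> t0 /tderiv_cvg ft /tderiv_cvg gt; have pf := tfilter_proper t0.
apply: tderiv_unique => //; rewrite /tquot.
under eq_fun do rewrite opprD addrACA scalerDr.
exact: cvgD.
Qed.

Lemma tderivZ V (f : R -> V) (e : R) t : 0 <= t -> tderivable f t ->
  tderivable (fun s => e *: f s) t /\
  tderiv (fun s => e *: f s) t = e *: tderiv f t.
Proof.
move=> t0 /tderiv_cvg ft; have pf := tfilter_proper t0.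
apply: tderiv_unique => //; rewrite /tquot.
under eq_fun do rewrite -scalerBr scalerA mulrC -scalerA.
exact: cvgZr.
Qed.

Lemma near_half_line t (Q : R -> Prop) : (forall s, 0 <= s -> Q s) ->
  \forall s \near t, 0 <= s -> Q s.
Proof. by move=> H; near=> s => s0; exact: H. Unshelve. all: by end_near. Qed.

Lemma tderivn_perturb V (x p : R -> V) (e : R) n k t :
  tCn n x -> tCn n p -> (k <= n)%N -> 0 <= t ->
  tderivn k (fun s => x s + e *: p s) t = tderivn k x t + e *: tderivn k p t.
Proof.
move=> [xd _] [pd _]; elim: k t => [//|k IH] t kn t0; rewrite /tderivn !iterS -!/(tderivn _ _).
have [pd1 pd2] := tderivZ e t0 (pd _ kn _ t0).
have [d1 d2] := tderivD t0 (xd _ kn _ t0) pd1.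
rewrite -pd2 -d2; apply: (tderivable_near_ext t0 _ d1).2.
by apply: near_half_line => s s0; rewrite IH// ltnW.
Qed.

(** The complement of [a, b] is open, so [f] vanishes at all nonnegative times near [t], and
    inductively so do its derivatives. *)
Lemma tderivn0_off V (f : R -> V) a b k :
  (forall t, 0 <= t -> ~ (a <= t <= b) -> f t = 0) ->
  forall t, 0 <= t -> ~ (a <= t <= b) -> tderivn k f t = 0.
Proof.
move=> f0; elim: k => [//|k IH] t t0 tab; rewrite /tderivn iterS -/(tderivn _ _).
have d0 : is_derive t (1:R) (cst (0:V)) 0 by exact: is_derive_cst.
have [d1 d2] := is_derive_tderiv t0 d0.
rewrite -d2; apply: (tderivable_near_ext t0 _ d1).2.
have [ta|at_] := ltP t a.
  have : \forall s \near t, s < a by exact: lt_nbhsl.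
  by apply: filterS => s sa s0; rewrite IH// leNgt sa.
have bt : b < t by rewrite ltNge; apply/negP => tb; apply: tab; rewrite at_.
have : \forall s \near t, b < s by exact: lt_nbhsr.
by apply: filterS => s sa s0; rewrite IH// [s <= b]leNgt sa andbF.
Qed.

End tderiv.

(** * Compactly supported bump functions of class C^n *)

Section bump.
Context {R : realType} (a b : R).

Let D : {poly R} := ('X - a%:P) * (b%:P - 'X).

(* The polynomials [q] clipped here are multiples of a power of [D]; they vanish
   to that order at a and b, so clipping keeps them differentiable. *)
Definition clip (q : {poly R}) (t : R) : R^o := if a <= t <= b then q.[t] else 0.

(** Vanishing to order at least [m] at both endpoints, expressed by divisibility. *)
Let flat m (q : {poly R}) := exists r, q = r * D ^+ m.

Let flat_deriv m q : flat m.+1 q -> flat m q^`().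
Proof.
move=> [r ->]; exists (r^`() * D + r * D^`() *+ m.+1).
rewrite derivM deriv_exp mulrDl exprS mulrA; congr (_ + _).
by rewrite mulrnAl -mulrA mulrnAr.
Qed.

Let flat_end m q t : flat m.+1 q -> (t == a) || (t == b) -> q.[t] = 0.
Proof.
move=> [r ->] tab; rewrite hornerM horner_exp /D !hornerE.
by case/orP : tab => /eqP ->; rewrite subrr ?mul0r ?mulr0 expr0n mulr0.
Qed.

(** At an endpoint [q] and its derivative vanish, and |[clip q]| <= |[q]| squeezes the difference
    quotient to 0; at any other point [clip q] is locally 0 or locally [q]. *)
Lemma clip_derive q t : flat 2 q -> is_derive t (1:R) (clip q) (clip q^`() t).
Proof.
move=> fq; have fq' := flat_deriv fq.
have [tab|tab] := boolP ((t == a) || (t == b)).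
  have qt := flat_end fq tab; have q't := flat_end fq' tab.
  have -> : clip q^`() t = 0 by rewrite /clip q't if_same.
  have clipt : clip q t = 0 by rewrite /clip qt if_same.
  have [dq dqE] := is_derive_poly q t.
  have q0 : h^-1 *: (q.[h *: (1:R) + t] - q.[t] : R^o) @[h --> (0:R)^'] --> (0:R^o).
    by rewrite -[0 in X in _ --> X]q't -dqE; exact: dq.
  have c0 : h^-1 *: (clip q (h *: (1:R) + t) - clip q t) @[h --> (0:R)^'] --> (0:R^o).
    rewrite clipt; move: q0; rewrite qt => q0.
    apply/cvgr0Pnorm_lt => e e0; have /cvgr0Pnorm_lt/(_ _ e0) := q0.
    apply: filterS => h; apply: le_lt_trans.
    rewrite !subr0 /clip; case: ifP => _ //.
    by rewrite scaler0 normr0 normr_ge0.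
  apply: DeriveDef; first exact: (cvgP _ c0).
  exact: cvg_lim c0.
have [ta|at_] := ltP t a.
  have -> : clip q^`() t = 0 by rewrite /clip leNgt ta.
  apply: (near_eq_is_derive _ (is_derive_cst (0:R^o) t (1:R))).
  by have := lt_nbhsl ta; apply: filterS => s sa; rewrite /clip leNgt sa.
have [bt|tb] := ltP b t.
  have -> : clip q^`() t = 0 by rewrite /clip [t <= b]leNgt bt andbF.
  apply: (near_eq_is_derive _ (is_derive_cst (0:R^o) t (1:R))).
  by have := lt_nbhsr bt; apply: filterS => s sb; rewrite /clip [s <= b]leNgt sb andbF.
move: tab; rewrite negb_or => /andP[ta_neq tb_neq].
have {}at_ : a < t by rewrite lt_neqAle eq_sym ta_neq.
have {}tb : t < b by rewrite lt_neqAle tb_neq.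
have -> : clip q^`() t = q^`().[t] by rewrite /clip !ltW.
apply: (near_eq_is_derive _ (is_derive_poly q t)).
have := lt_nbhsr at_; have := lt_nbhsl tb.
by apply: filterS2 => s sb sa; rewrite /clip !ltW.
Qed.

Let flat_derivn n k : flat (n - k) (D ^+ n)^`(k).
Proof.
elim: k => [|k IH]; first by rewrite subn0 derivn0; exists 1; rewrite mul1r.
rewrite derivnS subnS; case: (n - k)%N IH => [|m] //= IH.
  (* Truncated subtraction has reached 0, and flatness of order 0 is no condition. *)
  by exists ((D ^+ n)^`(k))^`(); rewrite expr0 mulr1.
exact: flat_deriv.
Qed.

(** The exponent n + 2 leaves a factor [D ^+ 2] after up to n derivatives, as [clip_derive]
    requires; each of these derivatives is then differentiable, hence continuous. *)
Definition bump n := clip (D ^+ n.+2).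

Let bump_derivn n k t : (k <= n)%N -> 0 <= t ->
  tderivn k (bump n) t = clip ((D ^+ n.+2)^`(k)) t.
Proof.
elim: k t => [|k IH] t kn t0; first by rewrite derivn0.
rewrite /tderivn iterS -/(tderivn _ _) derivnS.
have fk : flat 2 (D ^+ n.+2)^`(k).
  have [r ->] := flat_derivn n.+2 k.
  exists (r * D ^+ (n - k)); rewrite -mulrA -exprD; congr (_ * _ ^+ _).
  by rewrite -addn2 -addnBAC// ltnW.
have [d1 d2] := is_derive_tderiv t0 (clip_derive t fk).
rewrite -d2; apply: (tderivable_near_ext t0 _ d1).2.
by apply: near_half_line => s s0; rewrite IH// ltnW.
Qed.

Lemma bump_tCn n : tCn n (bump n).
Proof.
have fk k : (k <= n)%N -> flat 2 (D ^+ n.+2)^`(k).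
  move=> kn; have [r ->] := flat_derivn n.+2 k.
  exists (r * D ^+ (n - k)); rewrite -mulrA -exprD; congr (_ * _ ^+ _).
  by rewrite -addn2 -addnBAC.
split=> k kn.
  move=> t t0; have [d1 d2] := is_derive_tderiv t0 (clip_derive t (fk _ (ltnW kn))).
  apply: (tderivable_near_ext t0 _ d1).1.
  by apply: near_half_line => s s0; rewrite bump_derivn// ltnW.
(* The formula for the derivatives holds for t >= 0 only, but continuity within the half-line does
   not see other times. *)
apply: (@subspace_eq_continuous _ _ _ (clip (D ^+ n.+2)^`(k))).
  by move=> t; rewrite inE/= in_itv/= andbT => t0; exact: (esym (bump_derivn kn t0)).
apply: continuous_subspaceT => t.
apply: differentiable_continuous; apply/derivable1_diffP.
by have [] := clip_derive t (fk _ kn).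
Qed.

Lemma bump_gt0 n t : a < t < b -> 0 < bump n t.
Proof.
move=> /andP[at_ tb]; rewrite /bump /clip !ltW//= horner_exp exprn_gt0// /D !hornerE.
by rewrite mulr_gt0// subr_gt0.
Qed.

Lemma bump_ge0 n t : 0 <= bump n t.
Proof.
rewrite /bump /clip; case: ifP => // /andP[at_ tb].
by rewrite horner_exp exprn_ge0// /D !hornerE mulr_ge0// subr_ge0.
Qed.

Lemma bump_off n t : ~ (a <= t <= b) -> bump n t = 0.
Proof. by rewrite /bump /clip; case: ifP. Qed.

Lemma bump_continuous n : continuous (bump n).
Proof.
move=> t; apply: differentiable_continuous; apply/derivable1_diffP.
have f2 : flat 2 (D ^+ n.+2).
  by exists (D ^+ n); rewrite -exprD addn2.
by have [] := clip_derive t f2.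
Qed.

End bump.

(** * Measure theory *)

Import HBNNSimple.

Section measure.
Context {R : realType} d (T : measurableType d).

(* No measurability: the Lebesgue integral of the library is a lower integral,
   and a simple function below f can be cut off on a null set. *)
Lemma ge0_ae_le_integral (mu : {measure set T -> \bar R}) (f g : T -> \bar R) :
  (forall x, 0 <= f x)%E -> (forall x, 0 <= g x)%E ->
  {ae mu, forall x, f x = g x} -> (\int[mu]_x f x <= \int[mu]_x g x)%E.
Proof.
move=> f0 g0 [A [mA A0 fgA]].
rewrite !ge0_integralE// !patch_setT; apply: ge_ereal_sup => _ [h /= hf <-].
have mAc : measurable (~` A) by exact: measurableC.
pose h' := proj_nnsfun h mAc.
apply: ereal_sup_ubound; exists h'.
  move=> x; rewrite /= mindicE; have [xA|xA] := boolP (x \in ~` A).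
    rewrite mulr1; have <- : f x = g x; last exact: hf.
    by apply: contrapT => fg; move: xA; rewrite inE; apply; exact: fgA.
  by rewrite mulr0.
rewrite -!integralT_nnsfun; apply: ae_eq_integral => //.
- exact/measurable_EFinP/measurable_funP.
- exact/measurable_EFinP/measurable_funP.
exists A; split => // x hh'; apply: contrapT => Ax; apply: hh' => _.
by rewrite /= mindicE mem_set ?mulr1.
Qed.

(** The previous inequality is applied both ways to the positive and negative parts. The lemma
    serves for the boundary terms, whose measurability in [w] is not established. *)
Lemma ae_eq_integral_nomeas (mu : {measure set T -> \bar R}) (f g : T -> \bar R) :
  {ae mu, forall x, f x = g x} -> (\int[mu]_x f x = \int[mu]_x g x)%E.
Proof.
move=> fg; have gf : {ae mu, forall x, g x = f x} by apply: filterS fg => x ->.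
have pos (u v : T -> \bar R) : {ae mu, forall x, u x = v x} ->
    {ae mu, forall x, (u^\+ x = v^\+ x)%E} /\ {ae mu, forall x, (u^\- x = v^\- x)%E}.
  by move=> uv; split; apply: filterS uv => x; rewrite ?funeposE ?funenegE => ->.
rewrite integralE [RHS]integralE.
by congr (_ - _)%E; apply/eqP; rewrite eq_le; apply/andP; split;
  apply: ge0_ae_le_integral => //; apply pos.
Qed.

(** Round [t] down to the grid of step 1/(m+1). The rounded function is measurable, since it depends
    on [w] alone on each of countably many strips, and by continuity in [t] it tends to [f]
    pointwise. *)
Lemma measurable_fun_caratheodory (f : R -> T -> R) :
  (forall t, measurable_fun setT (f t)) -> (forall w, continuous (f ^~ w)) ->
  measurable_fun setT (fun x : R * T => f x.1 x.2).
Proof.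
move=> mf cf.
pose q (m : nat) (t : R) : R := (Num.floor (t * m.+1%:R))%:~R / m.+1%:R.
apply: (@measurable_fun_cvg _ _ _ _ (fun m (x : R * T) => f (q m x.1) x.2)); last first.
  move=> [t w] _ /=.
  have qt : q m t @[m --> \oo] --> t.
    apply/cvgrPdist_le => e e0; near=> m.
    have m0 : 0 < m.+1%:R :> R by [].
    have /andP[f1 f2] := floor_itv (t * m.+1%:R).
    have qle : q m t <= t by rewrite ler_pdivrMr.
    have ltq : t < q m t + m.+1%:R^-1.
      by rewrite /q -[X in _ + X]mul1r -mulrDl ltr_pdivlMr// -[1 in X in _ < X]/(1%:~R) -intrD.
    rewrite ger0_norm ?subr_ge0// lerBlDl (le_trans (ltW ltq))// lerD2l.
    by apply: ltW; near: m; exact: (near_infty_natSinv_lt (PosNum e0)).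
  exact: (cvg_comp _ _ qt (cf w t)).
move=> m _ Y mY; rewrite setTI.
rewrite (_ : _ @^-1` _ = \bigcup_(k in [set: int])
    ([set t | Num.floor (t * m.+1%:R) = k] `*` (f (k%:~R / m.+1%:R) @^-1` Y))); last first.
  apply/seteqP; split => [[t w] /= Yf|[t w] [k _] [/= <-]//].
  by exists (Num.floor (t * m.+1%:R)).
apply: countable_bigcupT_measurable => [|k]; first exact: countableP.
apply: measurableX; last by rewrite -[_ @^-1` _]setTI; exact: mf.
have m0 : 0 < m.+1%:R :> R by [].
rewrite (_ : [set t | _] = `[k%:~R / m.+1%:R, (k + 1)%:~R / m.+1%:R[%classic)//.
apply/seteqP; split => t /=; rewrite in_itv/= ler_pdivrMr// ltr_pdivlMr//.
  by move=> <-; exact: floor_itv.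
by move=> /floor_def.
Unshelve. all: by end_near. Qed.

End measure.

(** * Interchange of expectation and time integral *)

Section fubini.
Context {R : realType} d (T : measurableType d) (P : probability T R).
Local Notation leb := (@lebesgue_measure R).

(** Negative times receive the value at 0, because the criterion for joint measurability asks for
    continuity on the whole line. *)
Lemma continuous_extend_half (f : R -> R) :
  {within `[0, +oo[, continuous f} -> continuous (fun t : R => f (Num.max t 0)).
Proof.
move=> /subspace_continuousP cf t.
have m0 : `[0, +oo[%classic (Num.max t 0) by rewrite /= in_itv/= andbT le_max lexx orbT.
have cm : Num.max s 0 @[s --> t] --> within `[0, +oo[%classic (nbhs (Num.max t 0)).
  move=> A HA.
  have {}HA : nbhs (Num.max t 0) [set s | 0 <= s -> A s].
    have : nbhs (Num.max t 0) [set s | `[0, +oo[%classic s -> A s] by exact: HA.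
    by apply: filterS => s /= H s0; apply: H; rewrite in_itv/= s0.
  have cmax : Num.max s 0 @[s --> t] --> Num.max t 0.
    by apply: (@continuous_max _ _ (id : R -> R^o) (cst 0)); [exact: cvg_id|exact: cvg_cst].
  have : nbhs t [set s | 0 <= Num.max s 0 -> A (Num.max s 0)] by exact: (cmax _ HA).
  by apply: filterS => s; apply; rewrite le_max lexx orbT.
exact: (cvg_comp _ _ cm (cf _ m0)).
Qed.

(** Continuity in [t] makes [g] jointly measurable. Of [m] this is not asked: it is compared with
    |[g]| under the integral over [w], for each fixed [t], and its expectation then bounds the
    iterated integral of |[g]|. *)
Lemma fubini_segment (g m : R -> T -> R) (K : R) :
  (forall t, 0 <= t -> measurable_fun setT (g t)) ->
  (forall w, {within `[0, +oo[, continuous (g ^~ w)}) ->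
  (forall t w, 0 <= t -> `|g t w| <= m t w) ->
  (forall t, 0 <= t -> measurable_fun setT (m t)) ->
  leb.-integrable `[0, K] (fun t => \int[P]_w (m t w)%:E)%E ->
  [/\ leb.-integrable `[0, K] (fun t => \int[P]_w (g t w)%:E)%E,
      P.-integrable setT (fun w => \int[leb]_(t in `[0%R, K]) (g t w)%:E)%E
    & (\int[leb]_(t in `[0%R, K]) \int[P]_w (g t w)%:E =
      \int[P]_w \int[leb]_(t in `[0%R, K]) (g t w)%:E)%E].
Proof.
move=> mg cg gm mm im.
pose h t w := g (Num.max t 0) w.
have mh : measurable_fun setT (fun x : R * T => h x.1 x.2).
  apply: measurable_fun_caratheodory => [t|w].
    by apply: mg; rewrite le_max lexx orbT.
  exact: continuous_extend_half (cg w).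
(* The indicator replaces the segment by the whole line, so that Fubini's theorem applies on a
   product of full spaces. *)
pose F (x : R * T) : \bar R := (h x.1 x.2 * \1_`[0, K] x.1)%:E.
have mF : measurable_fun setT F.
  apply/measurable_EFinP; apply: measurable_funM => //.
  apply: (measurableT_comp (f := (\1_`[0, K] : R -> R))) => //.
have FE t w : F (t, w) = ((fun t => (g t w)%:E) \_ `[0, K]) t.
  rewrite /F /h/= patchE indicE; case: ifPn => [|_].
    by rewrite inE/= in_itv/= => /andP[t0 _]; rewrite max_l// mulr1.
  by rewrite mulr0.
have FPE t : (\int[P]_w F (t, w))%E = ((fun t => \int[P]_w (g t w)%:E)%E \_ `[0, K]) t.
  under eq_integral do rewrite FE patchE.
  by rewrite patchE; case: ifPn => // _; rewrite integral0.
have mim := measurable_int leb im.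
have iF : (leb \x P)%E.-integrable setT F.
  apply/integrable12ltyP => //.
  apply: (@le_lt_trans _ _ (\int[leb]_t ((fun t => \int[P]_w (m t w)%:E) \_ `[0%R, K]) t)%E).
    have mE : measurable_fun setT ((fun t => \int[P]_w (m t w)%:E)%E \_ `[0, K]).
      by apply/(measurable_restrictT _ _).1 => //; exact: mim.
    apply: ge0_le_integral => //.
    - by move=> t _; apply: integral_ge0.
    - apply: (@measurable_fun_fubini_tonelli_F _ _ _ _ _ P (abse \o F)) => //=.
      exact: measurableT_comp.
    move=> t _; rewrite patchE; case: ifPn => [tK|tK]; last first.
      by under eq_integral do rewrite FE patchE (negbTE tK) abse0; rewrite integral0.
    have /andP[t0 _] : 0 <= t <= K by move: tK; rewrite inE/= in_itv.
    apply: ge0_le_integral => //.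
    - apply: measurableT_comp => //; under eq_fun do rewrite FE patchE tK.
      exact/measurable_EFinP/mg.
    - exact/measurable_EFinP/mm.
    - by move=> w _; rewrite FE patchE tK lee_fin gm.
  rewrite -integral_mkcond; have /integrableP[_] := im.
  apply: le_lt_trans; apply: ge0_le_integral => //.
  - move=> t /=; rewrite in_itv/= => /andP[t0 _]; apply: integral_ge0 => w _.
    by rewrite lee_fin (le_trans _ (gm t w t0)).
  - by apply: measurableT_comp => //; exact: mim.
  - by move=> t _; exact: lee_abs.
split.
- have H : leb.-integrable setT ((fun t => \int[P]_w (g t w)%:E)%E \_ `[0, K]).
    by apply: eq_integrable (integrable_fubini_F iF) => // t _; exact: FPE.
  by have := (integrable_restrict leb (measurable_itv `[0, K]) measurableT _).2 H; rewrite setTI.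
- have iG : P.-integrable setT (fun w => \int[leb]_t F (t, w))%E.
    apply/integrableP; split; first exact: (measurable_fubini_G iF).
    apply: le_lt_trans ((integrable21ltyP leb P mF).1 iF).
    apply: ge0_le_integral => //.
    - by apply: measurableT_comp => //; exact: (measurable_fubini_G iF).
    - apply: (@measurable_fun_fubini_tonelli_G _ _ _ _ _ leb (abse \o F)) => //=.
      exact: measurableT_comp.
    move=> w _; apply: le_abse_integral => //.
    exact: measurable_fun_pair1.
  apply: eq_integrable iG => // w _.
  by rewrite [RHS]integral_mkcond; apply: eq_integral => t _; rewrite FE.
transitivity (\int[leb]_t \int[P]_w F (t, w))%E.
  by rewrite integral_mkcond; apply: eq_integral => t _; rewrite FPE.
rewrite (Fubini iF).
apply: eq_integral => w _.
by rewrite [RHS]integral_mkcond; apply: eq_integral => t _; rewrite FE.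
Qed.
End fubini.

(** * Integration by parts of the first variation *)

Section inner.
Context {R : realType} {N : nat}.
Implicit Types (f g : R -> 'rV[R]_N) (t : R).

Lemma innerDr (a b c : 'rV[R]_N) : inner a (b + c) = inner a b + inner a c.
Proof. by rewrite /inner -big_split; apply: eq_bigr => i _; rewrite mxE mulrDr. Qed.

Lemma innerZr (k : R) (a b : 'rV[R]_N) : inner a (k *: b) = k * inner a b.
Proof. by rewrite /inner mulr_sumr; apply: eq_bigr => i _; rewrite mxE mulrCA. Qed.

Lemma inner0r (a : 'rV[R]_N) : inner a 0 = 0.
Proof. by rewrite /inner big1// => i _; rewrite mxE mulr0. Qed.

Lemma inner0l (a : 'rV[R]_N) : inner 0 a = 0.
Proof. by rewrite /inner big1// => i _; rewrite mxE mul0r. Qed.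

Lemma inner_sumr (I : finType) (Q : pred I) (a : 'rV[R]_N) (F : I -> 'rV[R]_N) :
  inner a (\sum_(i | Q i) F i) = \sum_(i | Q i) inner a (F i).
Proof. by apply: (big_morph (inner a)) => [b c|]; [exact: innerDr|exact: inner0r]. Qed.

Lemma is_derive_coord f t df i :
  is_derive t (1:R) f df -> is_derive t (1:R) (fun s => f s 0 i : R^o) (df 0 i).
Proof.
move=> [fd fdE].
have H : h^-1 *: (f (h *: (1:R) + t) - f t) @[h --> (0:R)^'] --> df.
  by rewrite -fdE; exact: fd.
have H1 : h^-1 *: (f (h *: (1:R) + t) 0 i - f t 0 i : R^o) @[h --> (0:R)^'] --> (df 0 i : R^o).
  have := cvg_comp _ _ H (@coord_continuous _ _ _ 0 i df).
  apply: cvg_trans; apply: near_eq_cvg; apply: nearW => h.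
  by rewrite /= !mxE.
apply: DeriveDef; first exact: (cvgP _ H1).
exact: cvg_lim H1.
Qed.

Lemma is_derive_inner f g t df dg :
  is_derive t (1:R) f df -> is_derive t (1:R) g dg ->
  is_derive t (1:R) (fun s => inner (f s) (g s) : R^o)
    (inner df (g t) + inner (f t) dg).
Proof.
move=> fd gd.
have H i : is_derive t (1:R) ((fun s => f s 0 i : R^o) * (fun s => g s 0 i : R^o))
    (f t 0 i *: (dg 0 i : R^o) + g t 0 i *: (df 0 i : R^o)).
  by apply: is_deriveM; exact: is_derive_coord.
have sumE : (fun s => inner (f s) (g s) : R^o) =
    \sum_(i < N) ((fun s => f s 0 i : R^o) * (fun s => g s 0 i : R^o)).
  by apply/funext => s; rewrite fct_sumE.
rewrite sumE; apply: (is_derive_eq (is_derive_sum H)).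
rewrite /inner -big_split; apply: eq_bigr => i _ /=.
by rewrite addrC /GRing.scale/= [g t 0 i * _]mulrC.
Qed.

Lemma cvg_inner (T : Type) (F : set_system T) (FF : Filter F)
    (f g : T -> 'rV[R]_N) (a b : 'rV[R]_N) :
  f x @[x --> F] --> a -> g x @[x --> F] --> b ->
  inner (f x) (g x) @[x --> F] --> inner a b.
Proof.
move=> fa gb; rewrite /inner; apply: cvg_big => [|i _]; first exact: add_continuous.
apply: cvgM.
  exact: (cvg_comp _ _ fa (@coord_continuous _ _ _ 0 i a)).
exact: (cvg_comp _ _ gb (@coord_continuous _ _ _ 0 i b)).
Qed.

Lemma within_continuous_inner (A : set R) f g :
  {within A, continuous f} -> {within A, continuous g} ->
  {within A, continuous (fun s => inner (f s) (g s))}.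
Proof.
move=> /subspace_continuousP fc /subspace_continuousP gc.
apply/subspace_continuousP => t At.
by apply: cvg_inner; [exact: fc|exact: gc].
Qed.

Lemma within_continuousZ (A : set R) (k : R) f :
  {within A, continuous f} -> {within A, continuous (fun s => k *: f s)}.
Proof.
move=> /subspace_continuousP fc; apply/subspace_continuousP => t At.
by apply: cvgZr; exact: fc.
Qed.

Lemma within_continuous_sum (V : normedModType R) (A : set R) (I : finType)
    (Q : pred I) (F : I -> R -> V) :
  (forall i, Q i -> {within A, continuous (F i)}) ->
  {within A, continuous (fun s => \sum_(i | Q i) F i s)}.
Proof.
move=> Fc; apply/subspace_continuousP => t At.
apply: cvg_big => [|i Qi]; first exact: add_continuous.
by have /subspace_continuousP := Fc i Qi; apply.
Qed.

End inner.

Section first_variation.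
Context {R : realType} {N n : nat}.
Local Notation leb := (@lebesgue_measure R).
Local Notation half := (`[0%R, +oo[%classic : set R).
Variables (p : R -> 'rV[R]_N) (y : 'I_n.+1 -> R -> 'rV[R]_N).
Hypotheses (pC : tCn n p) (yC : forall k : 'I_n.+1, tCn k (y k)).

(** For one fixed outcome, with [y k] in the role of the gradient block [v_ k]: the first variation,
    the Euler expression and the boundary terms. *)
Let fv t := \sum_(k < n.+1) inner (tderivn k p t) (y k t).
Let el t := \sum_(k < n.+1) (-1) ^+ k *: tderivn k (y k) t.
Let bd t := \sum_(j < n) inner (tderivn j p t)
    (\sum_(k < n.+1 | (j < k)%N)
       (-1) ^+ (k - j.+1) *: tderivn (k - j.+1) (y k) t).

Let p_cont j : (j <= n)%N -> {within half, continuous (tderivn j p)}.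
Proof. exact: pC.2. Qed.

Let y_cont (k : 'I_n.+1) j : (j <= k)%N -> {within half, continuous (tderivn j (y k))}.
Proof. exact: (yC k).2. Qed.

Lemma first_variation_continuous : {within half, continuous fv}.
Proof.
apply: within_continuous_sum => k _; apply: within_continuous_inner.
  by apply: p_cont; rewrite -ltnS.
exact: (y_cont (j := 0)).
Qed.

Lemma euler_continuous : {within half, continuous el}.
Proof.
apply: within_continuous_sum => k _; apply: within_continuousZ.
exact: y_cont.
Qed.

Lemma boundary_continuous : {within half, continuous bd}.
Proof.
apply: within_continuous_sum => j _; apply: within_continuous_inner.
  by apply: p_cont; exact: ltnW.
apply: within_continuous_sum => k jk; apply: within_continuousZ.
by apply: y_cont; exact: leq_subr.
Qed.

(** For each k put c_j = (-1)^(k-j) <p^(j), y_k^(k-j)>. The j-th boundary term has derivative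
    c_(j+1) - c_j, and summing over j < k leaves c_k - c_0, the k-th term of [fv] minus that of <p,
    [el]>. *)
Lemma is_derive_boundary (t : R) : 0 < t ->
  is_derive t (1:R) (bd : R -> R^o) (fv t - inner (p t) (el t)).
Proof.
move=> t0.
(* Padding by 0 for j >= k makes the double sum rectangular, so that its order can be exchanged. *)
pose b (k : 'I_n.+1) (j : 'I_n) (s : R) : R^o :=
  if (j < k)%N then
    (-1) ^+ (k - j.+1) *: inner (tderivn j p s) (tderivn (k - j.+1) (y k) s) : R^o
  else 0.
pose c (k : 'I_n.+1) (j : nat) : R :=
  (-1) ^+ (k - j) * inner (tderivn j p t) (tderivn (k - j) (y k) t).
have bdE : bd = \sum_(k < n.+1) \sum_(j < n) b k j.
  apply/funext => s; rewrite fct_sumE /bd.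
  under [RHS]eq_bigr do rewrite fct_sumE.
  rewrite [RHS]exchange_big; apply: eq_bigr => j _ /=.
  rewrite inner_sumr big_mkcond; apply: eq_bigr => k _.
  by rewrite /b; case: ifP => // _; rewrite innerZr.
have bd1 (k : 'I_n.+1) (j : 'I_n) :
    is_derive t (1:R) (b k j) (if (j < k)%N then c k j.+1 - c k j else 0).
  rewrite /b; case: ifP => jk; last exact: is_derive_cst.
  have dp : is_derive t (1:R) (tderivn j p) (tderivn j.+1 p t).
    by apply: tderiv_is_derive => //; apply: pC.1 => //; exact: ltW.
  have dy : is_derive t (1:R) (tderivn (k - j.+1) (y k)) (tderivn (k - j) (y k) t).
    rewrite -(subnSK jk); apply: tderiv_is_derive => //.
    by apply: (yC k).1; [rewrite ltn_subrL (leq_ltn_trans _ jk)|exact: ltW].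
  apply: (is_derive_eq (is_deriveZ _ (is_derive_inner dp dy))).
  rewrite /c -[in (-1) ^+ (k - j)](subnSK jk) exprS /GRing.scale/=.
  by rewrite mulN1r mulNr opprK mulrDr.
rewrite bdE; apply: (is_derive_eq (is_derive_sum (fun k => is_derive_sum (bd1 k)))).
rewrite /fv inner_sumr -sumrB; apply: eq_bigr => k _.
rewrite -big_mkcond -(big_mkord (fun j => (j < k)%N) (fun j => c k j.+1 - c k j)) /=.
(* As k <= n, the condition j < k cuts the range down to 0, ..., k - 1, where the sum telescopes. *)
rewrite -(@big_nat_widen _ _ _ 0%N k n xpredT); last by rewrite -ltnS.
rewrite telescope_sumr// /c subnn subn0 expr0 mul1r innerZr.
by [].
Qed.

Lemma integral_first_variation T : 0 < T ->
  (\int[leb]_(t in `[0%R, T]) (fv t)%:E =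
   \int[leb]_(t in `[0%R, T]) (inner (p t) (el t))%:E + (bd T - bd 0)%:E)%E.
Proof.
move=> T0.
have sub : `[0, T]%classic `<=` half.
  by move=> t /=; rewrite !in_itv/= andbT => /andP[].
have fvc := continuous_subspaceW sub first_variation_continuous.
have elc : {within `[0, T], continuous (fun t => inner (p t) (el t))}.
  apply: continuous_subspaceW sub _; apply: within_continuous_inner.
    exact: (p_cont (j := 0)).
  exact: euler_continuous.
have bdc := continuous_subspaceW sub boundary_continuous.
have ifv : leb.-integrable `[0, T] (EFin \o fv).
  by apply: continuous_compact_integrable => //; exact: segment_compact.
have iel : leb.-integrable `[0, T] (EFin \o (fun t => inner (p t) (el t))).
  by apply: continuous_compact_integrable => //; exact: segment_compact.
have fin : (\int[leb]_(t in `[0%R, T]) (inner (p t) (el t))%:E)%E \is a fin_num.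
  exact: integrable_fin_num iel.
have H : (\int[leb]_(t in `[0%R, T]) (fv t - inner (p t) (el t))%:E = (bd T)%:E - (bd 0)%:E)%E.
  apply: (@continuous_FTC2 _ _ bd) => //.
  - apply/subspace_continuousP => t At; apply: cvgB.
      by have /subspace_continuousP := fvc; apply.
    by have /subspace_continuousP := elc; apply.
  - have [_ b0 bT] := (continuous_within_itvP bd T0).1 bdc.
    split => // t; rewrite in_itv/= => /andP[t0 _].
    by have [] := is_derive_boundary t0.
  - move=> t; rewrite in_itv/= => /andP[t0 _].
    by rewrite derive1E; have [_ ->] := is_derive_boundary t0.
move: H; under eq_integral do rewrite EFinB.
rewrite integralB_EFin// EFinB => <-.
by rewrite addeC subeK.
Qed.

End first_variation.

(** * The first-order condition *)

Section expectation.
Local Open Scope ereal_scope.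
Context d (T : measurableType d) {R : realType} (mu : {measure set T -> \bar R}).

(** If the positive part has finite integral, failure of integrability can only come from an
    infinite integral of the negative part. *)
Lemma integral_eqNy (f : T -> \bar R) : measurable_fun setT f ->
  \int[mu]_x f^\+ x < +oo -> ~ mu.-integrable setT f -> \int[mu]_x f x = -oo.
Proof.
move=> mf fp nf; rewrite integralE.
have ip : mu.-integrable setT f^\+.
  apply/integrableP; split; first exact: measurable_funepos.
  by under eq_integral do rewrite gee0_abs ?funepos_ge0//.
have -> : \int[mu]_x f^\- x = +oo.
  apply: contrapT => /eqP; rewrite -ltey => fn; apply: nf.
  have im : mu.-integrable setT f^\-.
    apply/integrableP; split; first exact: measurable_funeneg.
    by under eq_integral do rewrite gee0_abs ?funeneg_ge0//.
  by rewrite (funeposneg f); exact: integrableB.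
by rewrite /= addeNy// -ltey.
Qed.

(* f and h differ by an integrable function, so they are integrable together;
   otherwise both integrals are -oo, which the hypothesis on [+?] excludes. *)
Lemma integral_diff_quot (f h q : T -> R) (e : R) : (0 < e)%R ->
  measurable_fun setT f -> measurable_fun setT h ->
  \int[mu]_x (EFin \o f)^\+ x < +oo -> \int[mu]_x (EFin \o h)^\+ x < +oo ->
  (forall x, q x = e^-1 * (f x - h x))%R -> mu.-integrable setT (EFin \o q) ->
  (\int[mu]_x (f x)%:E +? - (\int[mu]_x (h x)%:E)) ->
  (e^-1)%:E * (\int[mu]_x (f x)%:E - (\int[mu]_x (h x)%:E)) = \int[mu]_x (q x)%:E.
Proof.
move=> e0 mf mh fp hp qE iq fh.
have ie : mu.-integrable setT (fun x => e%:E * (q x)%:E) by exact: integrableZl.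
have fE x : (f x)%:E = (h x)%:E + e%:E * (q x)%:E.
  by rewrite -EFinM -EFinD qE mulrA mulfV ?gt_eqF// mul1r addrC subrK.
have hE x : (h x)%:E = (f x)%:E - e%:E * (q x)%:E.
  by rewrite -EFinM -EFinB qE mulrA mulfV ?gt_eqF// mul1r opprB addrC subrK.
have [ih|nh] := pselect (mu.-integrable setT (EFin \o h)).
  have fin : \int[mu]_x (h x)%:E \is a fin_num by exact: integrable_fin_num ih.
  under eq_integral do rewrite fE.
  rewrite integralD// integralZl// addeAC subee// add0e muleA -EFinM.
  by rewrite mulVf ?gt_eqF// mul1e.
have nf : ~ mu.-integrable setT (EFin \o f).
  move=> if_; apply: nh; rewrite (_ : _ \o _ = (EFin \o f) \- (fun x => e%:E * (q x)%:E)).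
    exact: integrableB.
  by apply/funext => x /=; rewrite hE.
move: fh; rewrite (integral_eqNy _ fp nf); last exact/measurable_EFinP.
by rewrite (integral_eqNy _ hp nh)//; exact/measurable_EFinP.
Qed.

End expectation.

Lemma Ck_on_differentiable {R : realType} (V : normedModType R) k (A : set V) (f : V -> R) x :
  (0 < k)%N -> Ck_on k A f -> A x -> differentiable f x.
Proof. by case: k => // k _ [+ _]; exact. Qed.

(** * The first variation along the optimal path *)

Section variation.
Context {R : realType} {d : measure_display} {Omega : measurableType d}.
Context (P : probability Omega R) {N n : nat} (n_gt0 : (0 < n)%N).
Context (X : R -> Omega -> set 'M[R]_(n.+1, N)).
Context (v : 'M[R]_(n.+1, N) -> R -> Omega -> R) (x0 : Omega -> 'rV[R]_N).
Context (xs : R -> Omega -> 'rV[R]_N).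
Hypothesis v_smooth : forall t w, 0 <= t -> Ck_on n (interior (X t w)) (fun z => v z t w).
Hypothesis xs_optimal : optimal P X v x0 xs.
Hypothesis xs_interior : interior_path X xs.
Hypothesis xs_regular : euler_regular v xs.
Local Notation leb := (@lebesgue_measure R).

(** The directional derivative of [v] at [jet xs] in the direction [jet p]; see [diff_quot_cvg]. *)
Definition first_variation (p : R -> Omega -> 'rV[R]_N) t w : R :=
  \sum_(k < n.+1) inner (tderivn k (p ^~ w) t) (v_ v xs k w t).

(** Differentiability at an interior jet, available because n > 0, makes the directional derivative
    linear in the direction, so that it splits into partial derivatives. *)
Lemma diff_quot_cvg p t w (e : nat -> R) : 0 <= t -> (forall m, 0 < e m) ->
  e m @[m --> \oo] --> 0 ->
  diff_quot v xs p t (e m) w @[m --> \oo] --> first_variation p t w.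
Proof.
move=> t0 e0 ecvg.
have df := Ck_on_differentiable n_gt0 (v_smooth w t0) (xs_interior w t0).
have -> : first_variation p t w = 'D_(jet p t w) (fun z => v z t w) (jet xs t w).
  rewrite deriveE// [in RHS](matrix_sum_delta (jet p t w)) linear_sum.
  apply: eq_bigr => k _; rewrite linear_sum; apply: eq_bigr => i _.
  by rewrite linearZ/= !mxE -deriveE.
have := @diff_derivable _ _ _ _ _ (jet p t w) df => dv.
have ecvg' : e m @[m --> \oo] --> (0:R)^'.
  move=> A HA.
  have H0 : \forall z \near (0:R), z != 0 -> A z by exact: HA.
  have H1 : \forall m \near \oo, e m != 0 -> A (e m) by exact: (ecvg _ H0).
  suff : \forall m \near \oo, A (e m) by [].
  by apply: filterS H1 => m; apply; rewrite gt_eqF.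
have := cvg_comp _ _ ecvg' dv.
apply: cvg_trans; apply: near_eq_cvg; apply: nearW => m.
by rewrite /diff_quot /= [jet xs t w + _]addrC.
Qed.

Lemma jet_perturb p e t w : tCn n (xs ^~ w) -> tCn n (p ^~ w) -> 0 <= t ->
  jet (perturb xs p e) t w = jet xs t w + e *: jet p t w :> 'M[R]_(n.+1, N).
Proof.
move=> cx cp t0; apply/matrixP => k i; rewrite !mxE.
by rewrite /perturb (tderivn_perturb _ cx cp) ?mxE// -ltnS.
Qed.

(** * Optimality against a single perturbation *)

Section perturbation.
Variables (p : R -> Omega -> 'rV[R]_N) (et : R).
Hypotheses (et_gt0 : 0 < et) (pert : perturbation_curve P X v x0 xs p et).
Hypothesis a2 : assumption2 P v xs p et.
Variable mhat : R -> Omega -> R.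
Hypothesis mhat_bound : forall t e w, 0 <= t -> 0 < e <= et ->
  `|diff_quot v xs p t e w| < mhat t w.
Hypothesis mhat_int : forall t, 0 <= t -> P.-integrable setT (EFin \o mhat t).
Hypothesis mhat_int2 : forall T', 0 <= T' ->
  leb.-integrable `[0, T'] (fun t => 'E_P[mhat t]%E).

(** One concrete sequence of admissible sizes tending to 0, along which dominated convergence is
    applied. *)
Let e_ (m : nat) := et / m.+1%:R.

Let e_in m : 0 < e_ m <= et.
Proof.
rewrite /e_ divr_gt0//= ler_pdivrMr// ler_pMr//.
by rewrite ler1n.
Qed.

Let e_cvg : e_ m @[m --> \oo] --> 0.
Proof.
rewrite -[0](mulr0 et) /e_; apply: cvgMr.
exact: (@cvg_harmonic R).
Qed.

Let xsC w : tCn n (xs ^~ w).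
Proof. by have [[]] := xs_optimal. Qed.

Let measurable_perturbed e t : 0 <= t -> 0 < e <= et ->
  measurable_fun setT (fun w => v (jet xs t w + e *: jet p t w) t w) /\
  (\int[P]_w ((fun w => (v (jet xs t w + e *: jet p t w) t w)%:E)^\+ w) < +oo)%E.
Proof.
move=> t0 he; have [[_ _ _ /(_ t t0) H] _] := pert.2 _ he.
have E w : jet xs t w + e *: jet p t w = jet (perturb xs p e) t w :> 'M[R]_(n.+1, N).
  by rewrite jet_perturb//; exact: pert.1.
by under eq_fun do rewrite E; under [X in funepos X]eq_fun do rewrite E.
Qed.

Let measurable_base t : 0 <= t ->
  measurable_fun setT (fun w => v (jet xs t w) t w) /\
  (\int[P]_w ((fun w => (v (jet xs t w) t w)%:E)^\+ w) < +oo)%E.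
Proof. by move=> t0; have [[_ _ _ /(_ t t0) H] _] := xs_optimal; exact: H. Qed.

Let measurable_diff_quot t e : 0 <= t -> 0 < e <= et ->
  measurable_fun setT (diff_quot v xs p t e).
Proof.
move=> t0 he; apply: measurable_funM => //; apply: measurable_funB.
  exact: (measurable_perturbed t0 he).1.
exact: (measurable_base t0).1.
Qed.

(** Measurability in [w] is assumed of [v] along attainable paths, not of its partial derivatives;
    it passes to the pointwise limit of the difference quotients. *)
Let measurable_first_variation t : 0 <= t -> measurable_fun setT (first_variation p t).
Proof.
move=> t0; apply: (@measurable_fun_cvg _ _ _ _ (fun m => diff_quot v xs p t (e_ m))).
  by move=> m; exact: measurable_diff_quot.
by move=> w _; apply: diff_quot_cvg => // m; have /andP[] := e_in m.
Qed.

Let first_variation_bound t w : 0 <= t -> `|first_variation p t w| <= mhat t w.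
Proof.
move=> t0; have H : diff_quot v xs p t (e_ m) w @[m --> \oo] --> first_variation p t w.
  by apply: diff_quot_cvg => // m; have /andP[] := e_in m.
have Hn : `|diff_quot v xs p t (e_ m) w| @[m --> \oo] --> `|first_variation p t w|.
  exact: cvg_norm H.
rewrite -(cvg_lim _ Hn)//.
apply: limr_le; first exact: (cvgP _ Hn).
apply: nearW => m.
by apply: ltW; exact: mhat_bound.
Qed.

Let integrable_diff_quot t e : 0 <= t -> 0 < e <= et ->
  P.-integrable setT (EFin \o diff_quot v xs p t e).
Proof.
move=> t0 he; apply: le_integrable (mhat_int t0) => //.
  by apply/measurable_EFinP; exact: measurable_diff_quot.
move=> w _; rewrite /= lee_fin (le_trans (ltW (mhat_bound _ t0 he)))//.
exact: ler_norm.
Qed.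

Let A_integrandE t e : 0 <= t -> 0 < e <= et ->
  A_integrand P v xs p e t = (\int[P]_w (diff_quot v xs p t e w)%:E)%E.
Proof.
move=> t0 he; have [_ [ex _]] := pert.2 _ he; have := ex t t0.
rewrite /A_integrand /Ev_perturbed /Ev !unlock => fh.
have [mf fp] := measurable_perturbed t0 he.
have [mh hp] := measurable_base t0.
apply: (integral_diff_quot _ mf mh fp hp _ (integrable_diff_quot t0 he) fh) => //.
by have /andP[] := he.
Qed.

Let Efv t : \bar R := (\int[P]_w (first_variation p t w)%:E)%E.
Let fvC w : {within `[0, +oo[, continuous (first_variation p ^~ w)}.
Proof.
by apply: first_variation_continuous; [exact: pert.1|move=> k; exact: xs_regular].
Qed.

Lemma fubini_first_variation (K : R) : 0 <= K ->
  [/\ leb.-integrable `[0, K] Efv,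
      P.-integrable setT (fun w => \int[leb]_(t in `[0%R, K]) (first_variation p t w)%:E)%E
    & (\int[leb]_(t in `[0%R, K]) Efv t =
      \int[P]_w \int[leb]_(t in `[0%R, K]) (first_variation p t w)%:E)%E].
Proof.
move=> K0; apply: (@fubini_segment _ _ _ _ _ mhat) => //.
- by move=> t t0; have /measurable_EFinP := measurable_int P (mhat_int t0).
- by apply: eq_integrable (mhat_int2 K0) => // t _; rewrite unlock.
Qed.

Let A_integrand_cvg t : 0 <= t ->
  A_integrand P v xs p (e_ m) t @[m --> \oo] --> Efv t.
Proof.
move=> t0.
have [|||||_ _] := @dominated_convergence _ _ _ P setT measurableT
  (fun m w => (diff_quot v xs p t (e_ m) w)%:E)
  (fun w => (first_variation p t w)%:E) (EFin \o mhat t) => //.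
- by move=> m; apply/measurable_EFinP; exact: measurable_diff_quot.
- by apply/measurable_EFinP; exact: measurable_first_variation.
- apply: aeW => w _; apply: cvg_EFin; first exact: nearW.
  by apply: diff_quot_cvg => // m; have /andP[] := e_in m.
- exact: mhat_int.
- by apply: aeW => w m _; rewrite lee_fin ltW// mhat_bound.
by apply: cvg_trans; apply: near_eq_cvg; apply: nearW => m; rewrite A_integrandE.
Qed.

Let A_integrand_bound t e : 0 <= t -> 0 < e <= et ->
  (`|A_integrand P v xs p e t| <= 'E_P[mhat t])%E.
Proof.
move=> t0 he; rewrite A_integrandE// unlock.
apply: le_trans (le_abse_integral _ _ _) _ => //.
  exact/measurable_EFinP/measurable_diff_quot.
apply: ge0_le_integral => //.
- exact/measurableT_comp/measurable_EFinP/measurable_diff_quot.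
- by have := measurable_int P (mhat_int t0).
by move=> w _; rewrite lee_fin ltW// mhat_bound.
Qed.

Let measurable_A_integrand (K e : R) : 0 <= K -> 0 < e <= et ->
  measurable_fun `[0%R, K] (A_integrand P v xs p e).
Proof. by move=> K0 he; have [_ [_ /(_ _ K0)[]]] := pert.2 _ he. Qed.

(** Convergence in L^1 on [0, K] controls the integrals over all [0, T'] with T' <= K at once, which
    gives the uniformity in the horizon needed below. *)
Let A_integrand_L1 (K : R) : 0 <= K ->
  (\int[leb]_(t in `[0%R, K]) `|A_integrand P v xs p (e_ m) t - Efv t|)%E
    @[m --> \oo] --> 0%E.
Proof.
move=> K0.
have iE := (fubini_first_variation K0).
have [|||||_ + _] := @dominated_convergence _ _ _ leb `[0%R, K]%classic (measurable_itv _)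
  (fun m t => A_integrand P v xs p (e_ m) t) Efv (fun t => 'E_P[mhat t]%E) => //.
- by move=> m; exact: measurable_A_integrand.
- by have [/(measurable_int leb)] := iE.
- by apply: aeW => t /=; rewrite in_itv/= => /andP[t0 _]; exact: A_integrand_cvg.
- exact: mhat_int2.
- by apply: aeW => t m /=; rewrite in_itv/= => /andP[t0 _]; exact: A_integrand_bound.
Qed.

(** [V_fun] is e times [infA] and nondecreasing in the time, so its value at any [T] is at most its
    limit, which optimality bounds by 0. *)
Let infA_le0 (T e : R) : 0 < e <= et -> (infA P v xs p T e <= 0)%E.
Proof.
move=> he; have /andP[e0 _] := he.
have VE S : V_fun P v xs p e S = (e%:E * infA P v xs p S e)%E.
  by rewrite /V_fun /infA -ereal_inf_pZl// image_comp.
have V0 : (V_fun P v xs p e T <= 0)%E.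
  have [at_ ex] := pert.2 _ he.
  apply: le_trans (xs_optimal.2 p e e0 at_ ex).
  have Vmono : {homo V_fun P v xs p e : S S' / S <= S' >-> (S <= S')%E}.
    move=> S S' SS'; apply: le_ereal_inf => _ [T' /= T'S <-]; exists T' => //.
    by move: T'S; rewrite !in_itv/= !andbT; exact: le_trans.
  apply: lime_ge; first exact: nondecreasing_is_cvge.
  by near=> S; apply: Vmono; near: S; apply: nbhs_pinfty_ge; exact: num_real.
by move: V0; rewrite VE pmule_rle0// lte_fin.
Unshelve. all: by end_near. Qed.

Lemma integral_first_variation_le (T eta : R) : 0 < T -> 0 < eta ->
  exists2 T', T <= T' & (\int[leb]_(t in `[0%R, T']) Efv t <= eta%:E)%E.
Proof.
move=> T0 eta0.
have eta20 : 0 < eta / 2 by rewrite divr_gt0.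
have [S [ST Sbd Scvg]] := a2 T0.
(* Distances in [-oo, +oo] are measured through [contract]. With this radius, whatever is close to a
   nonpositive value lies below eta / 2. *)
have c0 : 0 < contract (eta / 2)%:E.
  by rewrite -[X in X < _](contract0 R) lt_contract lte_fin.
pose E := [set xy : \bar R * \bar R | ball xy.1 (contract (eta / 2)%:E) xy.2].
have entE : entourage E by exact: (entourage_ball (\bar R) (PosNum c0)).
have [m Hm] : exists m, forall e, 0 < e <= et -> (A_fun P v xs p (S m e) e <= (eta / 2)%:E)%E.
  have := Scvg [set h | forall e, `]0, et]%classic e -> E (infA P v xs p T e, h e)].
  case=> [|m _ /(_ m (leqnn _)) /= H].
    by apply/uniform_nbhs; exists E; split.
  exists m => e he; have := H e; rewrite /= in_itv/= => /(_ he).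
  rewrite /E /ball/= /ereal_ball => Hb.
  rewrite -le_contract; apply/ltW.
  have : contract (infA P v xs p T e) <= 0.
    by rewrite -(contract0 R) le_contract; exact: infA_le0.
  move: Hb; rewrite ltr_norml => /andP[+ _].
  by rewrite ltrBrDl ltrBlDr => H1 H2; rewrite (lt_le_trans H1)// gerDr.
(* The order of choices matters: [m] is independent of e by uniformity, so [K] bounds the times
   [S m e] for all sizes, and only then is the size [e_ i] chosen, depending on [K]. *)
have [K SK] := Sbd m.
have e0in := e_in 0%N.
have K0 : 0 <= K.
  by rewrite (le_trans (ltW T0))// (le_trans (ST m _ e0in))// SK.
have [i Hi] : exists i,
    (\int[leb]_(t in `[0%R, K]) `|A_integrand P v xs p (e_ i) t - Efv t| <= (eta / 2)%:E)%E.
  have lt0 : (0%:E < (eta / 2)%:E)%E by rewrite lte_fin.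
  have [i _ /(_ i (leqnn _)) /ltW H] := A_integrand_L1 K0 (open_ereal_lt' lt0).
  by exists i.
have ei := e_in i; set T' := S m (e_ i).
have T'0 : 0 <= T' by rewrite (le_trans (ltW T0))//; exact: ST.
have T'K : T' <= K by exact: SK.
exists T'; first exact: ST.
have mA := measurable_A_integrand T'0 ei.
have iA : leb.-integrable `[0, T'] (A_integrand P v xs p (e_ i)).
  apply: le_integrable (mhat_int2 T'0) => // t /=; rewrite in_itv/= => /andP[t0 _].
  by rewrite (le_trans (A_integrand_bound t0 ei))// lee_abs.
have [iE _ _] := fubini_first_variation T'0.
have sub : `[0, T']%classic `<=` `[0, K]%classic.
  by move=> t /=; rewrite !in_itv/= => /andP[-> /le_trans]; apply.
have -> : (\int[leb]_(t in `[0%R, T']) Efv t = A_fun P v xs p T' (e_ i) -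
    \int[leb]_(t in `[0%R, T']) (A_integrand P v xs p (e_ i) t - Efv t))%E.
  rewrite /A_fun (integralB _ iA iE)//.
  rewrite -(fineK (integrable_fin_num _ iA))// -(fineK (integrable_fin_num _ iE))//.
  by rewrite -!EFinB opprB addrC subrK.
(* Half of eta pays for [A_fun] at the near-minimizing time, the other half for the L^1 distance on
   the larger interval [0, K]. *)
rewrite (splitr eta) EFinD; apply: leeD; first exact: Hm.
have [iEK _ _] := fubini_first_variation K0.
have mAK := measurable_A_integrand K0 ei.
have mB : measurable_fun `[0, K]%classic (fun t => A_integrand P v xs p (e_ i) t - Efv t)%E.
  by apply: emeasurable_funB => //; exact: (measurable_int leb iEK).
apply: le_trans (lee_abs _) _; rewrite abseN.
apply: le_trans Hi.
apply: le_trans (le_abse_integral _ _ _) _ => //.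
  exact: measurable_funS mB.
apply: ge0_subset_integral => //.
exact: measurableT_comp.
Qed.

End perturbation.
Local Notation el := (euler_lhs v xs).
Local Notation bd := (boundary v xs).

(** The form in which the assumptions are used from here on. The expectation stands outside the time
    integral, since integration by parts is done for each fixed outcome. *)
Lemma assumptions123_first_variation p : assumptions123 P X v x0 xs p ->
  [/\ forall w, tCn n (p ^~ w),
      forall K, 0 <= K ->
        P.-integrable setT (fun w => \int[leb]_(t in `[0%R, K]) (first_variation p t w)%:E)%E
    & forall T eta, 0 < T -> 0 < eta -> exists2 T', T <= T' &
        (\int[P]_w \int[leb]_(t in `[0%R, T']) (first_variation p t w)%:E <= eta%:E)%E].
Proof.
move=> [et et0 [pert _ a2 [mhat [mb mi mi2]]]].
have fub K := fubini_first_variation et0 pert mb mi mi2 (K := K).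
split; first exact: pert.1.
  by move=> K /fub[].
move=> T eta T0 eta0.
have [T' TT' H] := integral_first_variation_le et0 pert a2 mb mi mi2 T0 eta0.
exists T' => //; have [_ _ <-] := fub T' (le_trans (ltW T0) TT').
exact: H.
Qed.

Lemma integral_first_variationE p w T : tCn n (p ^~ w) -> 0 < T ->
  (\int[leb]_(t in `[0%R, T]) (first_variation p t w)%:E =
   \int[leb]_(t in `[0%R, T]) (inner (p t w) (el t w))%:E + (bd p T w - bd p 0 w)%:E)%E.
Proof. by move=> pC T0; exact: (integral_first_variation pC (fun k => xs_regular k w)). Qed.

Lemma euler_lhs_continuous w : {within `[0, +oo[, continuous (el ^~ w)}.
Proof. exact: (euler_continuous (fun k => xs_regular k w)). Qed.

(** * The Euler equation *)

Section euler.
Hypothesis xs_assumptions : localized_assumptions P X v x0 xs.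

(** The event [F] is taken to be the set where the weighted integral [Q] is positive. The
    first-order inequality for the perturbation localized on [F] bounds the integral of the positive
    part of [Q] by every eta > 0. *)
Lemma ae_integral_bump_euler (a b : R) (u : 'rV[R]_N) : 0 < a -> a < b ->
  {ae P, forall w,
    (\int[leb]_(t in `[0%R, (b + 1)%R]) (bump a b n t * inner u (el t w))%:E <= 0)%E}.
Proof.
(* The horizon b + 1 is merely some time beyond the support. *)
move=> a0 ab; set T := b + 1.
have b0 : 0 < b by exact: lt_trans ab.
have bT : b < T by rewrite ltrDl.
have T0 : 0 < T by exact: lt_trans bT.
have [c [mc c0 H]] := xs_assumptions T0.
pose J w : \bar R := (\int[leb]_(t in `[0%R, T]) (bump a b n t * inner u (el t w))%:E)%E.
pose p F t w : 'rV[R]_N := (bump a b n t * (c w * \1_F w)) *: u.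
have ass F : measurable F -> assumptions123 P X v x0 xs (p F).
  move=> mF; apply: (H _ a b) => //; first exact: bump_tCn.
  exact: bump_off.
have pJ F K w : measurable F -> T <= K ->
    (\int[leb]_(t in `[0%R, K]) (first_variation (p F) t w)%:E = (c w * \1_F w)%:E * J w)%E.
  move=> mF TK; have K0 : 0 < K by exact: lt_le_trans TK.
  have [pC _ _] := assumptions123_first_variation (ass F mF).
  rewrite integral_first_variationE//.
  (* The support lies in [a, b] with 0 < a and b < K, so the boundary terms vanish at both ends. *)
  have p0 t : 0 <= t -> ~ (a <= t <= b) -> forall j, tderivn j (p F ^~ w) t = 0.
    move=> t0 tab j; apply: (tderivn0_off j _ t0 tab) => s s0 sab.
    by rewrite /p bump_off// mul0r scale0r.
  have bd0 t : 0 <= t -> ~ (a <= t <= b) -> bd (p F) t w = 0.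
    by move=> t0 tab; rewrite /boundary big1// => j _; rewrite p0// inner0l.
  have bdK : bd (p F) K w = 0.
    apply: bd0; first exact: ltW.
    by move=> /andP[_]; rewrite leNgt (lt_le_trans bT).
  have bd00 : bd (p F) 0 w = 0.
    by apply: bd0 => // /andP[]; rewrite leNgt a0.
  rewrite bdK bd00 subrr adde0.
  have subT : `[0, T]%classic `<=` `[0, K]%classic.
    by move=> t /=; rewrite !in_itv/= => /andP[-> /le_trans]; apply.
  have -> : (\int[leb]_(t in `[0%R, K]) (inner (p F t w) (el t w))%:E =
      \int[leb]_(t in `[0%R, T]) (inner (p F t w) (el t w))%:E)%E.
    rewrite integral_mkcond [RHS]integral_mkcond; apply: eq_integral => t _.
    rewrite !patchE; case: ifPn => tK; case: ifPn => tT //; last first.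
      by move: tK; rewrite (mem_set (subT _ (set_mem tT))).
    rewrite /p bump_off ?mul0r ?scale0r ?inner0l// => /andP[at_ tb].
    move: tT; rewrite notin_setE/= in_itv/=; apply; apply/andP; split.
      by rewrite (le_trans (ltW a0)).
    by rewrite (le_trans tb)// ltW.
  have cont : {within `[0, T], continuous (fun t => bump a b n t * inner u (el t w))}.
    have sub : `[0, T]%classic `<=` `[0, +oo[%classic.
      by move=> t /=; rewrite !in_itv/= andbT => /andP[].
    apply/subspace_continuousP => t tT; apply: cvgM.
      have /continuous_subspaceT/subspace_continuousP := @bump_continuous R a b n.
      by apply.
    apply: cvg_inner; first exact: cvg_cst.
    have /(continuous_subspaceW sub)/subspace_continuousP := @euler_lhs_continuous w.
    by apply.
  rewrite /J -integralZl//; last first.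
    by apply: continuous_compact_integrable => //; exact: segment_compact.
  apply: eq_integral => t _; rewrite -EFinM; congr EFin.
  rewrite /p /inner !mulr_sumr; apply: eq_bigr => i _; rewrite mxE.
  ring.
pose Q w : \bar R := ((c w)%:E * J w)%E.
(* The perturbation on all of [Omega] comes first: it makes [Q] measurable, so that [F] is an
   event. *)
have iQ : P.-integrable setT Q.
  have [_ /(_ T (ltW T0)) iT _] := assumptions123_first_variation (ass setT measurableT).
  apply: eq_integrable iT => // w _.
  by rewrite pJ// indicT mulr1.
have mQ := measurable_int P iQ.
pose F := [set w | (0 < Q w)%E].
have mF : measurable F.
  by rewrite -[F]setTI; apply: emeasurable_fun_o_infty.
have QF w : ((c w * \1_F w)%:E * J w)%E = (Q^\+ w)%E.
  rewrite funeposE indicE; have [wF|wF] := boolP (w \in F).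
    by rewrite mulr1; apply/esym/max_idPl; rewrite ltW//; move: wF; rewrite inE.
  rewrite mulr0 mul0e; apply/esym/max_idPr; rewrite leNgt; apply/negP => wF'.
  by move: wF; rewrite notin_setE.
have Qp0 : (\int[P]_w Q^\+ w = 0)%E.
  apply/eqP; rewrite eq_le integral_ge0 ?andbT//.
  apply/lee_addgt0Pr => eta eta0; rewrite add0e.
  have [_ _ /(_ T eta T0 eta0)[T' TT']] := assumptions123_first_variation (ass F mF).
  by under eq_integral do rewrite pJ// QF.
have : ae_eq P setT (Q^\+)%E (cst 0%E).
  apply/ae_eq_integral_abs => //; first exact: measurable_funepos.
  by under eq_integral do rewrite gee0_abs ?funepos_ge0//.
apply: filterS => w /= /(_ I); rewrite funeposE => /max_idPr.
by rewrite /Q pmule_rle0// lte_fin.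
Qed.

(** Countably many coordinates, signs and rational intervals produce a single null set. Outside it,
    a nonzero component of the Euler expression would keep its sign on a rational interval by
    continuity, and its integral against the bump would not be nonpositive. *)
Lemma ae_euler : {ae P, forall w, forall t, 0 <= t -> el t w = 0}.
Proof.
pose u (k : 'I_N * bool * (rat * rat)) : 'rV[R]_N := (-1) ^+ k.1.2 *: delta_mx 0 k.1.1.
pose a (k : 'I_N * bool * (rat * rat)) : R := ratr k.2.1.
pose b (k : 'I_N * bool * (rat * rat)) : R := ratr k.2.2.
pose good k w := 0 < a k -> a k < b k ->
  (\int[leb]_(t in `[0%R, (b k + 1)%R]) (bump (a k) (b k) n t * inner (u k) (el t w))%:E <= 0)%E.
(* Indices are coded by natural numbers to form a countable intersection of almost sure events;
   [good] is vacuous unless 0 < a < b. *)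
have : {ae P, forall w, forall m, forall k, unpickle m = Some k -> good k w}.
  apply: ae_foralln => m; case: (unpickle m) => [k|]; last by apply: aeW.
  have [ak|nak] := pselect (0 < a k /\ a k < b k).
    have := ae_integral_bump_euler (u k) ak.1 ak.2.
    by apply: filterS => w gw _ [<-] _ _.
  by apply: aeW => w _ [<-] a0 ab; case: nak.
apply: filterS => w Hw t0 t00; apply/rowP => i; rewrite mxE.
apply: contrapT => /eqP elt0.
pose s := el t0 w 0 i < 0.
pose g t := (-1) ^+ s * el t w 0 i.
have gt0 : 0 < g t0.
  rewrite /g mulr_sign /s; case: (ltP (el t0 w 0 i) 0) => el0; first by rewrite oppr_gt0.
  by rewrite lt_def elt0.
have gE t : inner ((-1) ^+ s *: delta_mx 0 i) (el t w) = g t.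
  rewrite /inner (bigD1 i)//= !mxE !eqxx mulr1 big1 ?addr0// => j ji.
  by rewrite !mxE (negbTE ji) andbF mulr0 mul0r.
have gc : {within `[0, +oo[, continuous g}.
  apply/subspace_continuousP => t th; apply: cvgMr.
  have /subspace_continuousP/(_ t th) H := @euler_lhs_continuous w.
  exact: (cvg_comp _ _ H (@coord_continuous _ _ _ 0 i _)).
(* Looking only to the right of [t0] also covers t0 = 0, as the bump must start at a positive
   time. *)
have [e e0 ge] : exists2 e, 0 < e & forall t, t0 < t < t0 + e -> 0 < g t.
  have /subspace_continuousP/(_ t0) := gc; rewrite /= in_itv/= andbT => /(_ t00) H.
  have : nbhs t0 [set t | `[0, +oo[%classic t -> 0 < g t] by exact: (H _ (lt_nbhsr gt0)).
  move=> /nbhs_ballP[e /= e0 eP]; exists e => // t /andP[t1 t2]; apply: eP.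
    by rewrite /ball/= ltr0_norm ?subr_lt0// opprB ltrBlDl.
  by rewrite /= in_itv/= andbT (le_trans t00)// ltW.
have [q2] := @rat_in_itvoo R t0 (t0 + e) ltac:(by rewrite ltrDl).
rewrite in_itv/= => /andP[t0q2 q2e].
have [q1] := @rat_in_itvoo R t0 (ratr q2) t0q2.
rewrite in_itv/= => /andP[t0q1 q12].
have q10 : 0 < ratr q1 :> R by exact: le_lt_trans t0q1.
have := Hw (pickle (i, s, (q1, q2))) _ (pickleK _) q10 q12.
rewrite /a /b /u/= => {}Hw.
pose D : set R := `[0, ratr q2 + 1]%classic.
pose f (t : R) : \bar R := (bump (ratr q1) (ratr q2) n t * g t)%:E.
have {}Hw : (\int[leb]_(t in D) f t <= 0)%E.
  by move: Hw; under eq_integral do rewrite gE.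
have inP (t : R) : ratr q1 <= t <= ratr q2 -> 0 < g t.
  by move=> /andP[t1 t2]; apply: ge; rewrite (lt_le_trans t0q1)//= (le_lt_trans t2).
have f0 t : (0 <= f t)%E.
  rewrite /f lee_fin; have [tin|tout] := boolP (ratr q1 <= t <= ratr q2).
    by rewrite mulr_ge0 ?bump_ge0// ltW// inP.
  by rewrite bump_off ?mul0r//; exact/negP.
have mf : measurable_fun D f.
  have sub : D `<=` `[0, +oo[%classic.
    by move=> t /=; rewrite !in_itv/= andbT => /andP[].
  have fc : {within D, continuous (fun t => bump (ratr q1) (ratr q2) n t * g t)}.
    apply/subspace_continuousP => t tD; apply: cvgM.
      have /continuous_subspaceT/subspace_continuousP := @bump_continuous R (ratr q1) (ratr q2) n.
      by apply.
    by have /(continuous_subspaceW sub)/subspace_continuousP := gc; apply.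
  by apply/measurable_EFinP; apply: subspace_continuous_measurable_fun fc; exact: measurable_itv.
have : ae_eq leb D f (cst 0%E).
  apply/(ae_eq_integral_abs leb (measurable_itv _) mf).
  under eq_integral do rewrite gee0_abs//.
  by apply/eqP; rewrite eq_le Hw integral_ge0.
move=> [A [mA A0 DA]].
(* The nonnegative [f] has nonpositive integral, so it vanishes off the null set [A]; being positive
   on this interval, it forces [A] to contain a set of positive measure. *)
have subA : `](ratr q1 : R), ratr q2[%classic `<=` A.
  move=> t /=; rewrite in_itv/= => /andP[t1 t2]; apply: DA => /= DA.
  have tD : D t.
    by rewrite /D/= in_itv/= (ltW (lt_trans q10 t1))/= (le_trans (ltW t2))// lerDl.
  have := DA tD; rewrite /f => -[] /eqP; rewrite mulf_eq0 => /orP[|].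
    by rewrite gt_eqF// bump_gt0// t1.
  by rewrite gt_eqF// inP// !ltW.
have : (leb `](ratr q1 : R), ratr q2[%classic <= leb A)%E.
  by apply: le_measure => //; rewrite inE.
by rewrite A0 lebesgue_measure_itv/= lte_fin q12 -EFinD lee_fin leNgt subr_gt0 q12.
Qed.

End euler.

(** * The transversality condition *)

Lemma transversality p : {ae P, forall w, forall t, 0 <= t -> el t w = 0} ->
  assumptions123 P X v x0 xs p ->
  (limf_einf (fun T : R => 'E_P[fun w => (bd p T w - bd p 0 w)%R])
     (+oo%R : set_system R) <= 0)%E.
Proof.
move=> el0 /assumptions123_first_variation[pC _ H].
(* The lower limit is a supremum of infima over neighbourhoods of +oo; each infimum is at most the
   value at one suitable time. *)
rewrite limf_einfE; apply: ge_ereal_sup => _ [V [M [_ MV]] <-].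
apply/lee_addgt0Pr => eta eta0; rewrite add0e.
(* The neighbourhood contains the times strictly beyond [M], hence the 1 added; the maximum with 1
   keeps the time positive. *)
have T0 : 0 < Num.max (M + 1) 1 by rewrite lt_max ltr01 orbT.
have [T' TT'] := H _ eta T0 eta0; apply: le_trans.
have T'0 : 0 < T' by exact: lt_le_trans TT'.
apply: ereal_inf_lbound; exists T'.
  by apply: MV; rewrite (lt_le_trans _ TT')// lt_max ltrDl ltr01.
rewrite unlock; apply: ae_eq_integral_nomeas.
apply: filterS el0 => w elw; rewrite integral_first_variationE//.
rewrite [X in (_ = X + _)%E](_ : _ = 0%E) ?add0e//.
apply: integral0_eq => t; rewrite /= in_itv/= => /andP[t0 _].
by rewrite elw// inner0r.
Qed.

End variation.

Theorem theorem1 (R : realType) (d : measure_display) (Omega : measurableType d)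
    (P : probability Omega R) (N n : nat) (N_gt0 : (0 < N)%N) (n_gt0 : (0 < n)%N)
    (X : R -> Omega -> set 'M[R]_(n.+1, N))
    (v : 'M[R]_(n.+1, N) -> R -> Omega -> R)
    (x0 : Omega -> 'rV[R]_N)
    (X_spaces : value_spaces X x0)
    (v_smooth : forall t w, 0 <= t -> Ck_on n (interior (X t w)) (fun z => v z t w))
    (xs : R -> Omega -> 'rV[R]_N)
    (xs_optimal : optimal P X v x0 xs)
    (xs_interior : interior_path X xs)
    (xs_regular : euler_regular v xs)
    (xs_assumptions : localized_assumptions P X v x0 xs) :
  {ae P, forall w, forall t, 0 <= t -> euler_lhs v xs t w = 0} /\
  (forall p : R -> Omega -> 'rV[R]_N, assumptions123 P X v x0 xs p ->
     (limf_einf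
        (fun T : R => 'E_P[fun w => (boundary v xs p T w - boundary v xs p 0 w)%R])
        (+oo%R : set_system R) <= 0)%E).
Proof.
have el0 := ae_euler n_gt0 v_smooth xs_optimal xs_interior xs_regular xs_assumptions.
split=> // p.
exact: (transversality n_gt0 v_smooth xs_optimal xs_interior xs_regular el0).
Qed.
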